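(* For every $k\in\mathbb{Z}_{>0}$, the symmetric Jones–Wenzl projector $\mathcal{JW}_k$ is the image of the Jones–Wenzl projector $JW_k$ in the Temperley–Lieb category $\mathcal{TL}$ under the functor $\mathcal{I}:\mathcal{TL}\to\mathbf{SymSp}(\mathfrak{sl}_2)$, i.e. $\mathcal{I}(JW_k)=\mathcal{JW}_k$.
   Context: Let $q$ be a generic parameter; everything is over $\mathbb{C}(q)$. For $a\in\mathbb{Z}$ put $[a]=\frac{q^a-q^{-a}}{q-q^{-1}}$; for $b\in\mathbb{Z}_{\ge 0}$ put $[b]!=[1][2]\cdots[b]$ ($[0]!=1$) and $\begin{bmatrix}a\\ b\end{bmatrix}=\frac{[a][a-1]\cdots[a-b+1]}{[b]!}$. **Symmetric spider.** $\mathbf{SymSp}(\mathfrak{sl}_2)$ is the $\mathbb{C}(q)$-linear monoidal category whose objects are finite tuples $\vec{k}\in\mathbb{Z}_{>0}^m$, $m\ge 0$ (including the empty tuple $\varnothing$), together with a zero object; $\otimes$ of objects is concatenation. Morphisms $\vec k\to\vec l$ are $\mathbb{C}(q)$-linear combinations of symmetric $\mathfrak{sl}_2$-webs: planar trivalent graphs with edges labeled by positive integers, with bottom boundary $\vec k$ and top boundary $\vec l$, taken up to boundary-preserving planar isotopy, generated under vertical gluing $\circ$ ($v\circ u$ is $v$ on top of $u$) and horizontal juxtaposition $\otimes$ by the identities $\mathrm{id}_k$, caps $\mathsf{cap}_k:(k,k)\to\varnothing$, cups $\mathsf{cup}_k:\varnothing\to(k,k)$, merges $m_{k,l}:(k,l)\to(k+l)$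 and splits $s^{k,l}:(k+l)\to(k,l)$. (Isotopy amounts locally to the zig-zag identities for each $\mathsf{cap}_k,\mathsf{cup}_k$ and the vertex slides $\mathsf{cap}_l(\mathrm{id}_l\otimes\mathsf{cap}_k\otimes\mathrm{id}_l)(s^{l,k}\otimes\mathrm{id}_k\otimes\mathrm{id}_l)=\mathsf{cap}_{k+l}(\mathrm{id}_{k+l}\otimes m_{k,l})$ and $\mathsf{cap}_k(\mathrm{id}_k\otimes\mathsf{cap}_l\otimes\mathrm{id}_k)(\mathrm{id}_k\otimes\mathrm{id}_l\otimes s^{l,k})=\mathsf{cap}_{k+l}(m_{k,l}\otimes\mathrm{id}_{k+l})$, together with the upside-down versions with cups.) Conventions: edges labeled $0$ are erased, and a diagram with a negative label is zero. Ladders: $F^{(j)}\mathbf 1_{(k,l)}=(\mathrm{id}_{k-j}\otimes m_{j,l})(s^{k-j,j}\otimes\mathrm{id}_l):(k,l)\to(k-j,l+j)$ and $E^{(j)}\mathbf 1_{(k,l)}=(m_{k,j}\otimes\mathrm{id}_{l-j})(\mathrm{id}_k\otimes s^{j,l-j}):(k,l)\to(k+j,l-j)$. The local relations imposed are: - associativity: $m_{h+k,l}(m_{h,k}\otimes\mathrm{id}_l)=m_{h,k+l}(\mathrm{id}_h\otimes m_{k,l})$ and $(s^{h,k}\otimes\mathrm{id}_l)s^{h+k,l}=(\mathrm{id}_h\otimes s^{k,l})s^{h,k+l}$; - digon removal: $m_{k,l}s^{k,l}=\begin{bmatrix}k+l\\ l\end{bmatrix}\mathrm{id}_{k+l}$;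 - square removal: $F^{(j_2)}F^{(j_1)}\mathbf 1_{(k,l)}=\begin{bmatrix}j_1+j_2\\ j_1\end{bmatrix}F^{(j_1+j_2)}\mathbf 1_{(k,l)}$, and the same with $E$ in place of $F$; - square switch: $E^{(j_2)}F^{(j_1)}\mathbf 1_{(k,l)}=\sum_{j'\ge0}\begin{bmatrix}k-j_1-l+j_2\\ j'\end{bmatrix}F^{(j_1-j')}E^{(j_2-j')}\mathbf 1_{(k,l)}$; - circle removal: $\mathsf{cap}_1\circ\mathsf{cup}_1=-[2]$; - dumbbell: $s^{1,1}\circ m_{1,1}=[2]\,\mathrm{id}_1\otimes\mathrm{id}_1+\mathsf{cup}_1\circ\mathsf{cap}_1$. **Symmetric Jones–Wenzl projectors.** Write $1^k=(1,\dots,1)$ ($k$ entries). Let $M_1=S_1=\mathrm{id}_1$, $M_k=m_{k-1,1}(M_{k-1}\otimes\mathrm{id}_1):1^k\to(k)$ and $S_k=(S_{k-1}\otimes\mathrm{id}_1)s^{k-1,1}:(k)\to1^k$. Then $\mathcal{JW}_k=\frac{1}{[k]!}\,S_k\circ M_k\in\mathrm{End}(1^k)$. **Temperley–Lieb.** $\mathcal{TL}$ is the $\mathbb{C}(q)$-linear monoidal category with objects $k\in\mathbb{Z}_{\ge0}$ and morphisms linear combinations of non-intersecting planar tangle diagrams up to boundary-preserving isotopy, modulo circle $=-[2]$. The Jones–Wenzl projectors are defined by $JW_1=\mathrm{id}_1$ and, for $k\ge2$, $$JW_k=JW_{k-1}\otimes\mathrm{id}_1+\frac{[k-1]}{[k]}(JW_{k-1}\otimes\mathrm{id}_1)\circ(\mathrm{id}_{k-2}\otimes(\mathsf{cup}\circ\mathsf{cap}))\circ(JW_{k-1}\otimes\mathrm{id}_1).$$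 The functor $\mathcal{I}:\mathcal{TL}\to\mathbf{SymSp}(\mathfrak{sl}_2)$ sends $k$ to $1^k$ and views a Temperley–Lieb diagram as a symmetric $\mathfrak{sl}_2$-web with all edges labeled $1$. *)

(* Defs.v *)
From HB Require Import structures.
From mathcomp Require Import all_boot all_order all_algebra.
From mathcomp Require Import generic_quotient fraction.
From mathcomp Require Import boolp reals complex.

Set Implicit Arguments.
Unset Strict Implicit.
Unset Printing Implicit Defensive.

Import GRing.Theory.
Local Open Scope ring_scope.
Local Open Scope quotient_scope.

Declare Scope tm_scope.
Delimit Scope tm_scope with tm.
Reserved Notation "g \oc f" (at level 45, left associativity).
Reserved Notation "f \ox g" (at level 40, left associativity).

(** * K-linear strict monoidal categories given by generators and relations

  A presentation consists of a monoid of objects, typed generating morphisms,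
  and a relation between formal morphisms.  Its morphisms a -> b are the
  well-typed formal expressions a -> b modulo the smallest congruence that
  contains the relations and the axioms of K-linear strict monoidal
  categories. *)

Record msig := MSig {
  ob : eqType;
  ob1 : ob;
  obM : ob -> ob -> ob;
  obMA : associative obM;
  ob1M : left_id ob1 obM;
  obM1 : right_id ob1 obM;
  gen : Type;
  gsrc : gen -> ob;
  gtgt : gen -> ob }.

Section Terms.
Variables (K : fieldType) (S : msig).

Inductive tm : Type :=
| tid of ob S
| tgen of gen S
| tcomp of tm & tm
| tten of tm & tm
| tzero of ob S & ob S
| tadd of tm & tm
| tscale of K & tm.

Fixpoint src (f : tm) : ob S :=
  match f with
  | tid a => a
  | tgen x => gsrc x
  | tcomp g f => src f
  | tten f g => obM (src f) (src g)
  | tzero a b => a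
  | tadd f g => src f
  | tscale c f => src f
  end.

Fixpoint tgt (f : tm) : ob S :=
  match f with
  | tid a => a
  | tgen x => gtgt x
  | tcomp g f => tgt g
  | tten f g => obM (tgt f) (tgt g)
  | tzero a b => b
  | tadd f g => tgt f
  | tscale c f => tgt f
  end.

Fixpoint wf (f : tm) : bool :=
  match f with
  | tid _ | tgen _ | tzero _ _ => true
  | tcomp g f => [&& wf g, wf f & tgt f == src g]
  | tten f g => wf f && wf g
  | tadd f g => [&& wf f, wf g, src f == src g & tgt f == tgt g]
  | tscale c f => wf f
  end.

Definition typed (a b : ob S) (f : tm) : bool :=
  [&& wf f, src f == a & tgt f == b].

Definition parallel (f g : tm) : bool :=
  [&& wf f, wf g, src f == src g & tgt f == tgt g].

End Terms.

Arguments tid {K S} _.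
Arguments tgen {K S} _.
Arguments tcomp {K S} _%_tm _%_tm.
Arguments tten {K S} _%_tm _%_tm.
Arguments tzero {K S} _ _.
Arguments tadd {K S} _%_tm _%_tm.
Arguments tscale {K S} _%_R _%_tm.
Arguments src {K S} _%_tm.
Arguments tgt {K S} _%_tm.
Arguments wf {K S} _%_tm.
Arguments typed {K S} _ _ _%_tm.
Arguments parallel {K S} _%_tm _%_tm.
Bind Scope tm_scope with tm.

Notation "g \oc f" := (tcomp g f) : tm_scope.
Notation "f \ox g" := (tten f g) : tm_scope.
Notation "f + g" := (tadd f g) : tm_scope.
Notation "c *: f" := (tscale c f) : tm_scope.

HB.instance Definition _ (K : fieldType) (S : msig) := gen_eqMixin (tm K S).
HB.instance Definition _ (K : fieldType) (S : msig) := gen_choiceMixin (tm K S).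

Section Congruence.
Variables (K : fieldType) (S : msig).
Local Notation tm := (tm K S).
Local Open Scope tm_scope.

Inductive lincat_axiom : tm -> tm -> Prop :=
| Ax_compA h g f : lincat_axiom (h \oc (g \oc f)) ((h \oc g) \oc f)
| Ax_comp1 f : lincat_axiom (tid (tgt f) \oc f) f
| Ax_1comp f : lincat_axiom (f \oc tid (src f)) f
| Ax_tenA f g h : lincat_axiom (f \ox (g \ox h)) ((f \ox g) \ox h)
| Ax_1ten f : lincat_axiom (tid (ob1 S) \ox f) f
| Ax_ten1 f : lincat_axiom (f \ox tid (ob1 S)) f
| Ax_ten_id a b : lincat_axiom (tid a \ox tid b) (tid (obM a b))
| Ax_interchange g g' f f' :
    lincat_axiom ((g \oc f) \ox (g' \oc f')) ((g \ox g') \oc (f \ox f'))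
| Ax_addA f g h : lincat_axiom (f + (g + h)) ((f + g) + h)
| Ax_addC f g : lincat_axiom (f + g) (g + f)
| Ax_add0 f : lincat_axiom (tzero (src f) (tgt f) + f) f
| Ax_scaleA (c d : K) f : lincat_axiom (c *: (d *: f)) ((c * d)%R *: f)
| Ax_scale1 f : lincat_axiom (1%R *: f) f
| Ax_scale0 f : lincat_axiom (0%R *: f) (tzero (src f) (tgt f))
| Ax_scaleDr (c : K) f g : lincat_axiom (c *: (f + g)) (c *: f + c *: g)
| Ax_scaleDl (c d : K) f : lincat_axiom ((c + d)%R *: f) (c *: f + d *: f)
| Ax_compDl h g f : lincat_axiom ((h + g) \oc f) (h \oc f + g \oc f)
| Ax_compDr h g f : lincat_axiom (h \oc (g + f)) (h \oc g + h \oc f)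
| Ax_compZl (c : K) g f : lincat_axiom ((c *: g) \oc f) (c *: (g \oc f))
| Ax_compZr (c : K) g f : lincat_axiom (g \oc (c *: f)) (c *: (g \oc f))
| Ax_tenDl h g f : lincat_axiom ((h + g) \ox f) (h \ox f + g \ox f)
| Ax_tenDr h g f : lincat_axiom (h \ox (g + f)) (h \ox g + h \ox f)
| Ax_tenZl (c : K) g f : lincat_axiom ((c *: g) \ox f) (c *: (g \ox f))
| Ax_tenZr (c : K) g f : lincat_axiom (g \ox (c *: f)) (c *: (g \ox f)).

Lemma typed_comp (a b c : ob S) (g f : tm) :
  typed b c g -> typed a b f -> typed a c (g \oc f).
Proof.
by rewrite /typed /= => /and3P[-> /eqP-> ->] /and3P[-> -> /eqP->]; rewrite eqxx.
Qed.

Lemma typed_ten (a b c d : ob S) (f g : tm) :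
  typed a b f -> typed c d g -> typed (obM a c) (obM b d) (f \ox g).
Proof.
rewrite /typed /= => /and3P[-> /eqP-> /eqP->] /and3P[-> /eqP-> /eqP->].
by rewrite !eqxx.
Qed.

Lemma typed_parallel (a b : ob S) (f g : tm) :
  typed a b f -> typed a b g -> parallel f g.
Proof.
rewrite /typed /parallel => /and3P[-> /eqP-> /eqP->] /and3P[-> /eqP-> /eqP->].
by rewrite !eqxx.
Qed.

Variable R : tm -> tm -> Prop.

(* Axioms and relations are imposed only between well-typed expressions with
   the same source and target; [tmeq_parallel] below shows that no derivation
   between well-typed expressions passes through an ill-typed one. *)
Inductive tmeq : tm -> tm -> Prop :=
| tmeq_ax f g : lincat_axiom f g -> parallel f g -> tmeq f g
| tmeq_rel f g : R f g -> parallel f g -> tmeq f g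
| tmeq_refl f : tmeq f f
| tmeq_sym f g : tmeq f g -> tmeq g f
| tmeq_trans g f h : tmeq f g -> tmeq g h -> tmeq f h
| tmeq_comp g g' f f' : tmeq g g' -> tmeq f f' -> tmeq (g \oc f) (g' \oc f')
| tmeq_ten f f' g g' : tmeq f f' -> tmeq g g' -> tmeq (f \ox g) (f' \ox g')
| tmeq_add f f' g g' : tmeq f f' -> tmeq g g' -> tmeq (f + g) (f' + g')
| tmeq_scale c f f' : tmeq f f' -> tmeq (c *: f) (c *: f').

Lemma tmeq_parallel f g :
  tmeq f g -> [/\ wf f = wf g, src f = src g & tgt f = tgt g].
Proof.
elim=> {f g} //=.
- by move=> f g _ /and4P[-> -> /eqP-> /eqP->].
- by move=> f g _ /and4P[-> -> /eqP-> /eqP->].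
- by move=> f g _ [-> -> ->].
- by move=> g f h _ [-> -> ->] _ [-> -> ->].
- by move=> g g' f f' _ [-> -> ->] _ [-> -> ->].
- by move=> g g' f f' _ [-> -> ->] _ [-> -> ->].
- by move=> g g' f f' _ [-> -> ->] _ [-> -> ->].
Qed.

Section Hom.
Variables a b : ob S.

Definition wtm := {f : tm | typed a b f}.

Definition wtm_eq (f g : wtm) : bool := `[< tmeq (val f) (val g) >].

Lemma wtm_eq_refl : reflexive wtm_eq.
Proof. by move=> f; apply/asboolP; apply: tmeq_refl. Qed.

Lemma wtm_eq_sym : symmetric wtm_eq.
Proof. by move=> f g; apply/asboolP/asboolP; apply: tmeq_sym. Qed.

Lemma wtm_eq_trans : transitive wtm_eq.
Proof.
by move=> g f h /asboolP fg /asboolP gh; apply/asboolP; apply: tmeq_trans gh.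
Qed.

Canonical wtm_equiv := EquivRel wtm_eq wtm_eq_refl wtm_eq_sym wtm_eq_trans.

Definition Hom := {eq_quot wtm_equiv}.

Definition hom (f : tm) (fab : typed a b f) : Hom :=
  \pi_Hom (exist _ f fab : wtm).

Lemma hom_eqP f g (fab : typed a b f) (gab : typed a b g) :
  hom fab = hom gab <-> tmeq f g.
Proof.
rewrite /hom; split=> [/eqmodP/asboolP|fg] //.
by apply/eqmodP/asboolP.
Qed.

End Hom.
End Congruence.

Arguments Hom {K S} R a b.
Arguments hom {K S} R {a b} f fab.

Section QuantumNumbers.
Variables (K : fieldType) (q : K).

Definition qint (a : int) : K := (q ^ a - q ^ (- a)) / (q - q^-1).

Definition qfact (b : nat) : K := \prod_(1 <= i < b.+1) qint i.

Definition qbin (a : int) (b : nat) : K :=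
  (\prod_(i < b) qint (a - i%:Z)) / qfact b.

End QuantumNumbers.

(** * The Temperley-Lieb category

  Planar tangle diagrams up to boundary-preserving isotopy form the strict
  monoidal category generated by cup and cap subject to the zig-zag
  identities. *)

Inductive TLgen := TLcap | TLcup.

Definition TLsig : msig := {|
  ob := nat;
  ob1 := 0%N;
  obM := addn;
  obMA := addnA;
  ob1M := add0n;
  obM1 := addn0;
  gen := TLgen;
  gsrc := fun x => if x is TLcap then 2%N else 0%N;
  gtgt := fun x => if x is TLcap then 0%N else 2%N |}.

Section TemperleyLieb.
Variables (K : fieldType) (q : K).
Local Notation tm := (tm K TLsig).
Local Open Scope tm_scope.

Definition tl_id (n : nat) : tm := @tid K TLsig n.
Definition tl_cap : tm := @tgen K TLsig TLcap.
Definition tl_cup : tm := @tgen K TLsig TLcup.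

Inductive TLrel : tm -> tm -> Prop :=
| TL_zigzag_l : TLrel ((tl_cap \ox tl_id 1) \oc (tl_id 1 \ox tl_cup)) (tl_id 1)
| TL_zigzag_r : TLrel ((tl_id 1 \ox tl_cap) \oc (tl_cup \ox tl_id 1)) (tl_id 1)
| TL_circle : TLrel (tl_cap \oc tl_cup) ((- qint q 2)%R *: tl_id 0).

Definition TL (k l : nat) := @Hom K TLsig TLrel k l.

(* The value at k = 0 is irrelevant. *)
Fixpoint JW_tm (k : nat) : tm :=
  match k with
  | 0 => tl_id 0
  | 1 => tl_id 1
  | (n.+1 as k1).+1 =>
      let p := JW_tm k1 \ox tl_id 1 in
      p + (qint q n.+1 / qint q n.+2)%R *:
            (p \oc (tl_id n \ox (tl_cup \oc tl_cap)) \oc p)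
  end.

Lemma JW_typed k : typed (S := TLsig) k k (JW_tm k).
Proof.
suff H : forall n, typed (S := TLsig) n n (JW_tm n) /\
                   typed (S := TLsig) n.+1 n.+1 (JW_tm n.+1) by case: (H k).
elim=> [|n [_ IH]]; split=> //; move: IH.
rewrite /typed [JW_tm n.+2]/= => /and3P[/= -> /eqP -> /eqP ->] /=.
by rewrite !addn1 !addn2 !eqxx.
Qed.

Definition JW (k : nat) : TL k k := hom TLrel (JW_tm k) (JW_typed k).

End TemperleyLieb.

(* [None] is the zero object, [Some s] the tuple s of positive integers. *)
Definition spob := option (seq {k : nat | (0 < k)%N}).

Definition spcat (a b : spob) : spob :=
  if a is Some s then if b is Some t then Some (s ++ t) else None else None.

Lemma spcatA : associative spcat.
Proof. by move=> [s|] [t|] [u|] //=; rewrite catA. Qed.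

Lemma spcat1 : left_id (Some [::]) spcat.
Proof. by case. Qed.

Lemma spcat2 : right_id (Some [::]) spcat.
Proof. by case=> //= s; rewrite cats0. Qed.

(* The boundary point of an edge with integer label: an edge labeled 0 is
   erased, a negative label gives the zero object.  A diagram with a negative
   label thus factors through the zero object, hence is zero. *)
Definition edge (a : int) : spob :=
  match a with
  | Posz 0 => Some [::]
  | Posz n.+1 => Some [:: exist _ n.+1 isT]
  | Negz _ => None
  end.

Arguments spcat : simpl never.
Arguments edge : simpl never.

Definition ones (k : nat) : spob := Some (nseq k (exist _ 1%N isT)).

(* [SpCap k : (k,k) -> 0], [SpCup k : 0 -> (k,k)],
   [SpMrg k l : (k,l) -> (k+l)], [SpSpl k l : (k+l) -> (k,l)] *)
Inductive SpGen :=
| SpCap of int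
| SpCup of int
| SpMrg of int & int
| SpSpl of int & int.

Definition SpSig : msig := {|
  ob := spob;
  ob1 := Some [::];
  obM := spcat;
  obMA := spcatA;
  ob1M := spcat1;
  obM1 := spcat2;
  gen := SpGen;
  gsrc := fun x => match x with
                   | SpCap k => spcat (edge k) (edge k)
                   | SpCup k => Some [::]
                   | SpMrg k l => spcat (edge k) (edge l)
                   | SpSpl k l => edge (k + l)
                   end;
  gtgt := fun x => match x with
                   | SpCap k => Some [::]
                   | SpCup k => spcat (edge k) (edge k)
                   | SpMrg k l => edge (k + l)
                   | SpSpl k l => spcat (edge k) (edge l)
                   end |}.

Lemma ones_cat k l : spcat (ones k) (ones l) = ones (k + l).
Proof. by rewrite /ones /spcat cat_nseq nseqD /ncons cat_nseq. Qed.

Section SymmetricSpider.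
Variables (K : fieldType) (q : K).
Local Notation tm := (tm K SpSig).
Local Open Scope tm_scope.

Definition sp_unit : tm := @tid K SpSig (Some [::]).
Definition sp_id (k : int) : tm := @tid K SpSig (edge k).
Definition sp_cap (k : int) : tm := @tgen K SpSig (SpCap k).
Definition sp_cup (k : int) : tm := @tgen K SpSig (SpCup k).
Definition mrg (k l : int) : tm := @tgen K SpSig (SpMrg k l).
Definition spl (k l : int) : tm := @tgen K SpSig (SpSpl k l).

Arguments sp_id k%_R.
Arguments mrg (k l)%_R.
Arguments spl (k l)%_R.

Definition ladF (j k l : int) : tm :=
  (sp_id (k - j) \ox mrg j l) \oc (spl (k - j) j \ox sp_id l).

Definition ladE (j k l : int) : tm :=
  (mrg k j \ox sp_id (l - j)) \oc (sp_id k \ox spl j (l - j)).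

Arguments ladF (j k l)%_R.
Arguments ladE (j k l)%_R.

(* The labels h k l j1 j2 range over all natural numbers; [Sp_cap0] to
   [Sp_spl0r] erase the 0-labeled edges.  [Sp_zigzag_l] to [Sp_cup_slide_r]
   are the planar isotopies, the interchange law being [Ax_interchange]. *)
Inductive SpRel : tm -> tm -> Prop :=
| Sp_zero_object : SpRel (@tid K SpSig None) (@tzero K SpSig None None)
| Sp_cap0 : SpRel (sp_cap 0) sp_unit
| Sp_cup0 : SpRel (sp_cup 0) sp_unit
| Sp_mrg0l (l : nat) : SpRel (mrg 0 l) (sp_id l)
| Sp_mrg0r (k : nat) : SpRel (mrg k 0) (sp_id k)
| Sp_spl0l (l : nat) : SpRel (spl 0 l) (sp_id l)
| Sp_spl0r (k : nat) : SpRel (spl k 0) (sp_id k)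
| Sp_zigzag_l (k : nat) :
    SpRel ((sp_cap k \ox sp_id k) \oc (sp_id k \ox sp_cup k)) (sp_id k)
| Sp_zigzag_r (k : nat) :
    SpRel ((sp_id k \ox sp_cap k) \oc (sp_cup k \ox sp_id k)) (sp_id k)
| Sp_cap_slide_l (k l : nat) :
    SpRel (sp_cap l \oc (sp_id l \ox sp_cap k \ox sp_id l)
             \oc (spl l k \ox sp_id k \ox sp_id l))
          (sp_cap (k + l)%N \oc (sp_id (k + l)%N \ox mrg k l))
| Sp_cap_slide_r (k l : nat) :
    SpRel (sp_cap k \oc (sp_id k \ox sp_cap l \ox sp_id k)
             \oc (sp_id k \ox sp_id l \ox spl l k))
          (sp_cap (k + l)%N \oc (mrg k l \ox sp_id (k + l)%N))
| Sp_cup_slide_l (k l : nat) :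
    SpRel ((mrg l k \ox sp_id k \ox sp_id l)
             \oc (sp_id l \ox sp_cup k \ox sp_id l) \oc sp_cup l)
          ((sp_id (k + l)%N \ox spl k l) \oc sp_cup (k + l)%N)
| Sp_cup_slide_r (k l : nat) :
    SpRel ((sp_id k \ox sp_id l \ox mrg l k)
             \oc (sp_id k \ox sp_cup l \ox sp_id k) \oc sp_cup k)
          ((spl k l \ox sp_id (k + l)%N) \oc sp_cup (k + l)%N)
| Sp_mrgA (h k l : nat) :
    SpRel (mrg (h + k)%N l \oc (mrg h k \ox sp_id l))
          (mrg h (k + l)%N \oc (sp_id h \ox mrg k l))
| Sp_splA (h k l : nat) :
    SpRel ((spl h k \ox sp_id l) \oc spl (h + k)%N l)
          ((sp_id h \ox spl k l) \oc spl h (k + l)%N)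
| Sp_digon (k l : nat) :
    SpRel (mrg k l \oc spl k l) (qbin q (k + l)%N l *: sp_id (k + l)%N)
| Sp_squareF (j1 j2 k l : nat) :
    SpRel (ladF j2 (k%:Z - j1%:Z) (l%:Z + j1%:Z) \oc ladF j1 k l)
          (qbin q (j1 + j2)%N j1 *: ladF (j1 + j2)%N k l)
| Sp_squareE (j1 j2 k l : nat) :
    SpRel (ladE j2 (k%:Z + j1%:Z) (l%:Z - j1%:Z) \oc ladE j1 k l)
          (qbin q (j1 + j2)%N j1 *: ladE (j1 + j2)%N k l)
(* square switch; the terms of the sum with j > j1 have a negative label *)
| Sp_switch (j1 j2 k l : nat) :
    SpRel (ladE j2 (k%:Z - j1%:Z) (l%:Z + j1%:Z) \oc ladF j1 k l)
      (\big[tadd/@tzero K SpSig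
               (spcat (edge k) (edge l))
               (spcat (edge (k%:Z - j1%:Z + j2%:Z)%R)
                      (edge (l%:Z + j1%:Z - j2%:Z)%R))]_(0 <= j < j1.+1)
         (qbin q (k%:Z - j1%:Z - l%:Z + j2%:Z)%R j *:
           (ladF (j1%:Z - j%:Z) (k%:Z + (j2%:Z - j%:Z)) (l%:Z - (j2%:Z - j%:Z))
              \oc ladE (j2%:Z - j%:Z) k l)))
| Sp_circle : SpRel (sp_cap 1 \oc sp_cup 1) ((- qint q 2)%R *: sp_unit)
| Sp_dumbbell :
    SpRel (spl 1 1 \oc mrg 1 1)
          (qint q 2 *: (sp_id 1 \ox sp_id 1) + sp_cup 1 \oc sp_cap 1).

Lemma ladF_typed (j k l : int) :
  typed (S := SpSig) (spcat (edge k) (edge l))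
    (spcat (edge (k - j)%R) (edge (l + j)%R)) (ladF j k l).
Proof. by rewrite /typed /= -!spcatA subrK (addrC l) !eqxx. Qed.

Lemma ladE_typed (j k l : int) :
  typed (S := SpSig) (spcat (edge k) (edge l))
    (spcat (edge (k + j)%R) (edge (l - j)%R)) (ladE j k l).
Proof. by rewrite /typed /= -!spcatA (addrC j) subrK !eqxx. Qed.

(* No relation is void for typing reasons. *)
Lemma SpRel_parallel f g : SpRel f g -> parallel f g.
Proof.
have e0 : edge 0 = Some [::] by [].
case=> {f g} //.
1-13: by intros; rewrite /parallel /= ?PoszD ?add0r ?addr0 ?e0 ?spcat1 ?spcat2
        ?spcatA ?addrA -?PoszD 1?[(l + k)%N]addnC ?addnA ?eqxx.
- move=> j1 j2 k l; rewrite PoszD.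
  apply: typed_parallel (ladF_typed (j1%:Z + j2%:Z) k l).
  have := ladF_typed j2 (k%:Z - j1%:Z) (l%:Z + j1%:Z).
  by rewrite opprD !addrA => /typed_comp; apply; apply: ladF_typed.
- move=> j1 j2 k l; rewrite PoszD.
  apply: typed_parallel (ladE_typed (j1%:Z + j2%:Z) k l).
  have := ladE_typed j2 (k%:Z + j1%:Z) (l%:Z - j1%:Z).
  by rewrite opprD !addrA => /typed_comp; apply; apply: ladE_typed.
- move=> j1 j2 k l; set a := spcat _ _; set b := spcat _ _.
  apply: (@typed_parallel _ SpSig a b).
    by apply: typed_comp (ladE_typed _ _ _) (ladF_typed _ _ _).
  apply: (big_ind (typed (S := SpSig) a b)) => [|f g /and3P[wf_ /eqP sf /eqP tf]
    /and3P[wg /eqP sg /eqP tg]|j _].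
  + by rewrite /typed /= !eqxx.
  + by rewrite /typed /= wf_ wg sf sg tf tg !eqxx.
  have := ladF_typed (j1%:Z - j%:Z) (k%:Z + (j2%:Z - j%:Z))
                     (l%:Z - (j2%:Z - j%:Z)).
  have -> : (k%:Z + (j2%:Z - j%:Z) - (j1%:Z - j%:Z) = k%:Z - j1%:Z + j2%:Z)%R.
    by rewrite opprB addrA -(addrA k%:Z) subrK addrAC.
  have -> : (l%:Z - (j2%:Z - j%:Z) + (j1%:Z - j%:Z) = l%:Z + j1%:Z - j2%:Z)%R.
    by rewrite opprB -addrA [(_ + (j1%:Z - _))%R]addrC !addrA subrK.
  by move=> /typed_comp; apply; apply: ladE_typed.
Qed.

Definition SymSp (a b : spob) := @Hom K SpSig SpRel a b.

(* The values at k = 0 are irrelevant. *)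
Fixpoint symM (k : nat) : tm :=
  match k with
  | 0 => sp_unit
  | 1 => sp_id 1
  | (n.+1 as k1).+1 => mrg k1 1 \oc (symM k1 \ox sp_id 1)
  end.

Fixpoint symS (k : nat) : tm :=
  match k with
  | 0 => sp_unit
  | 1 => sp_id 1
  | (n.+1 as k1).+1 => (symS k1 \ox sp_id 1) \oc spl k1 1
  end.

Definition symJW_tm (k : nat) : tm := (qfact q k)^-1 *: (symS k \oc symM k).

Lemma symM_typed (k : nat) : typed (S := SpSig) (ones k) (edge k%:Z) (symM k).
Proof.
elim: k => // -[//|k] IH.
have t1 : typed (S := SpSig) (ones 1) (edge 1) (sp_id 1) by [].
apply: (@typed_comp _ SpSig _ (spcat (edge k.+1) (edge 1))).
  by rewrite /typed /= -PoszD addn1 !eqxx.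
by move: (typed_ten IH t1); rewrite /= ones_cat addn1.
Qed.

Lemma symS_typed (k : nat) : typed (S := SpSig) (edge k) (ones k) (symS k).
Proof.
elim: k => // -[//|k] IH.
have t1 : typed (S := SpSig) (edge 1) (ones 1) (sp_id 1) by [].
apply: (@typed_comp _ SpSig _ (spcat (edge k.+1) (edge 1))).
  by move: (typed_ten IH t1); rewrite /= ones_cat addn1.
by rewrite /typed /= -PoszD addn1 !eqxx.
Qed.

Lemma symJW_typed (k : nat) : typed (S := SpSig) (ones k) (ones k) (symJW_tm k).
Proof. exact: typed_comp (symS_typed k) (symM_typed k). Qed.

Definition symJW (k : nat) : SymSp (ones k) (ones k) :=
  hom SpRel (symJW_tm k) (symJW_typed k).

Fixpoint TLtoSp_tm (f : Defs.tm K TLsig) : tm :=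
  match f with
  | tid n => @tid K SpSig (ones n)
  | tgen TLcap => sp_cap 1
  | tgen TLcup => sp_cup 1
  | tcomp g f => TLtoSp_tm g \oc TLtoSp_tm f
  | tten f g => TLtoSp_tm f \ox TLtoSp_tm g
  | tzero n m => @tzero K SpSig (ones n) (ones m)
  | tadd f g => TLtoSp_tm f + TLtoSp_tm g
  | tscale c f => c *: TLtoSp_tm f
  end.

Lemma src_TLtoSp f : src (TLtoSp_tm f) = ones (src f).
Proof. by elim: f => //= [[]|f -> g ->] //; rewrite ones_cat. Qed.

Lemma tgt_TLtoSp f : tgt (TLtoSp_tm f) = ones (tgt f).
Proof. by elim: f => //= [[]|f -> g ->] //; rewrite ones_cat. Qed.

Lemma wf_TLtoSp f : wf f -> wf (TLtoSp_tm f).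
Proof.
elim: f => //= [[]|g IHg f IHf|f IHf g IHg|f IHf g IHg] //.
- by case/and3P=> /IHg-> /IHf-> /eqP e; rewrite src_TLtoSp tgt_TLtoSp e eqxx.
- by case/andP=> /IHf-> /IHg->.
- case/and4P=> /IHf-> /IHg-> /eqP e1 /eqP e2.
  by rewrite !src_TLtoSp !tgt_TLtoSp e1 e2 !eqxx.
Qed.

Lemma TLtoSp_typed k l f :
  typed (S := TLsig) k l f ->
  typed (S := SpSig) (ones k) (ones l) (TLtoSp_tm f).
Proof.
by case/and3P=> /wf_TLtoSp wff /eqP<- /eqP<-;
  rewrite /typed wff src_TLtoSp tgt_TLtoSp !eqxx.
Qed.

Lemma TLtoSp_parallel f g :
  parallel f g -> parallel (TLtoSp_tm f) (TLtoSp_tm g).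
Proof.
case/and4P=> wff wfg /eqP e1 /eqP e2.
by rewrite /parallel !wf_TLtoSp // !src_TLtoSp !tgt_TLtoSp e1 e2 !eqxx.
Qed.

Lemma TLtoSp_axiom f g :
  lincat_axiom f g -> lincat_axiom (TLtoSp_tm f) (TLtoSp_tm g).
Proof.
case=> {f g} /= [h g f|f|f|f g h|f|f|a b|g g' f f'|f g h|f g|f|c d f|f|f|c f g
  |c d f|h g f|h g f|c g f|c g f|h g f|h g f|c g f|c g f];
  by rewrite -?ones_cat -?src_TLtoSp -?tgt_TLtoSp; constructor.
Qed.

Lemma TLtoSp_tmeq f g :
  tmeq (TLrel q) f g -> tmeq SpRel (TLtoSp_tm f) (TLtoSp_tm g).
Proof.
elim=> {f g} /=.
- by move=> f g /TLtoSp_axiom ax /TLtoSp_parallel; apply: tmeq_ax.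
- move=> f g rel /TLtoSp_parallel; apply: tmeq_rel.
  by case: rel; [apply: (Sp_zigzag_l 1)|apply: (Sp_zigzag_r 1)|apply: Sp_circle].
- by move=> f; apply: tmeq_refl.
- by move=> f g _; apply: tmeq_sym.
- by move=> g f h _ fg _; apply: tmeq_trans.
- by move=> g g' f f' _ gg _; apply: tmeq_comp.
- by move=> f f' g g' _ ff _; apply: tmeq_ten.
- by move=> f f' g g' _ ff _; apply: tmeq_add.
- by move=> c f f' _; apply: tmeq_scale.
Qed.

Definition TLtoSp (k l : nat) (x : TL q k l) : SymSp (ones k) (ones l) :=
  hom SpRel (TLtoSp_tm (val (repr x))) (TLtoSp_typed (valP (repr x))).

Lemma TLtoSp_hom k l f (fkl : typed (S := TLsig) k l f) :
  TLtoSp (hom (TLrel q) f fkl) = hom SpRel (TLtoSp_tm f) (TLtoSp_typed fkl).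
Proof.
apply/hom_eqP/TLtoSp_tmeq.
by have /eqmodP/asboolP := reprK (hom (TLrel q) f fkl).
Qed.

End SymmetricSpider.

(* R is the field of real numbers. *)
Definition Cq (R : realType) : fieldType := {fraction {poly R[i]}}.

Definition qvar (R : realType) : Cq R := tofrac 'X.

(* Main.v *)
(* Write M_k and S_k for the merge and split trees, so that M_k S_k = [k]!.
   Expanding the dumbbell, cup o cap = s m - [2] id on two strands; the square
   switch rewrites the resulting ladder EF on (n+1, 1) as s m + [n] id, whence
     (m_{n,1} (x) 1) (1 (x) cup o cap) (s^{n,1} (x) 1) = s m - [n+2] id.
   Substituting this into the Jones-Wenzl recursion at k = n+2, the multiple
   of the identity cancels JW_{n+1} (x) 1, leaving S_{n+2} M_{n+2} / [n+2]!. *)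
Require Import Defs.
From Stdlib Require Import Setoid Morphisms.
From mathcomp Require Import all_boot all_order all_algebra.
From mathcomp Require Import fraction reals complex ring.

Set Implicit Arguments.
Unset Strict Implicit.
Unset Printing Implicit Defensive.

Import GRing.Theory.
Local Open Scope ring_scope.

#[local] Hint Resolve tmeq_refl : core.

(** * Equational calculus in a presented linear monoidal category *)

Section LinearMonoidalCalculus.
Variables (K : fieldType) (S : msig) (R : tm K S -> tm K S -> Prop).
Local Open Scope tm_scope.
Local Notation "f ≡ g" := (tmeq R f g) (at level 70).
Implicit Types f g h : tm K S.

#[export] Instance tmeq_equiv : Equivalence (tmeq R).
Proof.
by split; [exact: tmeq_refl|exact: tmeq_sym|move=> f g h; apply: tmeq_trans].
Qed.

#[export] Instance tcomp_proper :
  Proper (tmeq R ==> tmeq R ==> tmeq R) (@tcomp K S).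
Proof. by move=> f f' e g g' e'; apply: tmeq_comp. Qed.

#[export] Instance tten_proper :
  Proper (tmeq R ==> tmeq R ==> tmeq R) (@tten K S).
Proof. by move=> f f' e g g' e'; apply: tmeq_ten. Qed.

#[export] Instance tadd_proper :
  Proper (tmeq R ==> tmeq R ==> tmeq R) (@tadd K S).
Proof. by move=> f f' e g g' e'; apply: tmeq_add. Qed.

#[export] Instance tscale_proper (c : K) :
  Proper (tmeq R ==> tmeq R) (@tscale K S c).
Proof. by move=> f f' e; apply: tmeq_scale. Qed.

(** Axioms are imposed only between parallel terms, so the rules below carry well-formedness
    hypotheses, from which parallelism follows. *)
Lemma tm_compA h g f : wf (h \oc g \oc f) -> h \oc (g \oc f) ≡ h \oc g \oc f.
Proof.
move=> w; apply: tmeq_ax; first exact: Ax_compA.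
move: w; rewrite /parallel /= => /and3P[/and3P[-> -> ->] -> ->].
by rewrite !eqxx.
Qed.

Lemma tm_comp1 a f : wf f -> tgt f = a -> tid a \oc f ≡ f.
Proof.
move=> w <-; apply: tmeq_ax; first exact: Ax_comp1.
by rewrite /parallel /= w !eqxx.
Qed.

Lemma tm_1comp a f : wf f -> src f = a -> f \oc tid a ≡ f.
Proof.
move=> w <-; apply: tmeq_ax; first exact: Ax_1comp.
by rewrite /parallel /= w !eqxx.
Qed.

Lemma tm_tenA f g h : wf f -> wf g -> wf h ->
  f \ox (g \ox h) ≡ f \ox g \ox h.
Proof.
move=> wf1 wg wh; apply: tmeq_ax; first exact: Ax_tenA.
by rewrite /parallel /= wf1 wg wh !obMA !eqxx.
Qed.

Lemma tm_1ten f : wf f -> tid (ob1 S) \ox f ≡ f.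
Proof.
move=> w; apply: tmeq_ax; first exact: Ax_1ten.
by rewrite /parallel /= w !ob1M !eqxx.
Qed.

Lemma tm_ten1 f : wf f -> f \ox tid (ob1 S) ≡ f.
Proof.
move=> w; apply: tmeq_ax; first exact: Ax_ten1.
by rewrite /parallel /= w !obM1 !eqxx.
Qed.

Lemma tm_ten_id a b : tid a \ox tid b ≡ @tid K S (obM a b).
Proof.
by apply: tmeq_ax; [exact: Ax_ten_id | rewrite /parallel /= !eqxx].
Qed.

Lemma tm_interchange g g' f f' : wf (g \oc f) -> wf (g' \oc f') ->
  (g \ox g') \oc (f \ox f') ≡ (g \oc f) \ox (g' \oc f').
Proof.
move=> w w'; apply/tmeq_sym/tmeq_ax; first exact: Ax_interchange.
move: w w'; rewrite /parallel /= => /and3P[-> -> /eqP->] /and3P[-> -> /eqP->].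
by rewrite !eqxx.
Qed.

Lemma tm_scaleA c d f : wf f -> c *: (d *: f) ≡ (c * d)%R *: f.
Proof.
move=> w; apply: tmeq_ax; first exact: Ax_scaleA.
by rewrite /parallel /= w !eqxx.
Qed.

Lemma tm_scale1 f : wf f -> 1%R *: f ≡ f.
Proof.
move=> w; apply: tmeq_ax; first exact: Ax_scale1.
by rewrite /parallel /= w !eqxx.
Qed.

Lemma tm_addA f g h : wf (f + g + h) -> f + (g + h) ≡ f + g + h.
Proof.
move=> w; apply: tmeq_ax; first exact: Ax_addA.
move: w; rewrite /parallel /=.
move=> /and4P[/and4P[-> -> /eqP-> /eqP->] -> /eqP-> /eqP->].
by rewrite !eqxx.
Qed.

Lemma tm_addC f g : wf (f + g) -> f + g ≡ g + f.
Proof.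
move=> w; apply: tmeq_ax; first exact: Ax_addC.
by move: w; rewrite /parallel /= => /and4P[-> -> /eqP-> /eqP->]; rewrite !eqxx.
Qed.

Lemma tm_add0 a b f : typed a b f -> tzero a b + f ≡ f.
Proof.
move=> /and3P[w /eqP<- /eqP<-]; apply: tmeq_ax; first exact: Ax_add0.
by rewrite /parallel /= w !eqxx.
Qed.

Lemma tm_scale0 f : wf f -> 0%R *: f ≡ tzero (src f) (tgt f).
Proof.
move=> w; apply: tmeq_ax; first exact: Ax_scale0.
by rewrite /parallel /= w !eqxx.
Qed.

Lemma tm_scaleDr c f g : wf (f + g) -> c *: (f + g) ≡ c *: f + c *: g.
Proof.
move=> w; apply: tmeq_ax; first exact: Ax_scaleDr.
by move: w; rewrite /parallel /= => /and4P[-> -> -> ->]; rewrite !eqxx.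
Qed.

Lemma tm_scaleDl c d f : wf f -> c *: f + d *: f ≡ (c + d)%R *: f.
Proof.
move=> w; apply/tmeq_sym/tmeq_ax; first exact: Ax_scaleDl.
by rewrite /parallel /= w !eqxx.
Qed.

Lemma tm_compDl h g f : wf (h + g) -> wf f -> tgt f = src g ->
  (h + g) \oc f ≡ h \oc f + g \oc f.
Proof.
move=> w wf1 e; apply: tmeq_ax; first exact: Ax_compDl.
move: w; rewrite /parallel /= => /and4P[-> -> /eqP-> ->].
by rewrite wf1 e !eqxx.
Qed.

Lemma tm_compDr h g f : wf (g + f) -> wf h -> src h = tgt f ->
  h \oc (g + f) ≡ h \oc g + h \oc f.
Proof.
move=> w wh e; apply: tmeq_ax; first exact: Ax_compDr.
move: w; rewrite /parallel /= => /and4P[-> -> -> /eqP->].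
by rewrite wh e !eqxx.
Qed.

Lemma tm_compZl c g f : wf (g \oc f) -> (c *: g) \oc f ≡ c *: (g \oc f).
Proof.
move=> w; apply: tmeq_ax; first exact: Ax_compZl.
by move: w; rewrite /parallel /= => /and3P[-> -> ->]; rewrite !eqxx.
Qed.

Lemma tm_compZr c g f : wf (g \oc f) -> g \oc (c *: f) ≡ c *: (g \oc f).
Proof.
move=> w; apply: tmeq_ax; first exact: Ax_compZr.
by move: w; rewrite /parallel /= => /and3P[-> -> ->]; rewrite !eqxx.
Qed.

Lemma tm_tenDr h g f : wf (g + f) -> wf h ->
  h \ox (g + f) ≡ h \ox g + h \ox f.
Proof.
move=> w wh; apply: tmeq_ax; first exact: Ax_tenDr.
move: w; rewrite /parallel /= => /and4P[-> -> /eqP-> /eqP->].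
by rewrite wh !eqxx.
Qed.

Lemma tm_tenZl c g f : wf g -> wf f -> (c *: g) \ox f ≡ c *: (g \ox f).
Proof.
move=> wg w; apply: tmeq_ax; first exact: Ax_tenZl.
by rewrite /parallel /= w wg !eqxx.
Qed.

Lemma tm_tenZr c g f : wf g -> wf f -> g \ox (c *: f) ≡ c *: (g \ox f).
Proof.
move=> wg w; apply: tmeq_ax; first exact: Ax_tenZr.
by rewrite /parallel /= w wg !eqxx.
Qed.

(** Terms have no negation, so scaling by [- c] replaces it: the scalars add up to 0, and [0 *: f]
    is the zero morphism. The rule serves to solve the dumbbell relation for cup-cap. *)
Lemma tm_subr_eq c f g h : h ≡ c *: f + g -> wf h ->
  g ≡ h + (- c)%R *: f.
Proof.
move=> e; have [-> _ _] := tmeq_parallel e.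
move=> /= /and4P[wff wfg /eqP es /eqP et].
rewrite e tm_addC /= ?wff ?wfg ?es ?et ?eqxx //.
rewrite tm_addA /= ?wff ?wfg ?es ?et ?eqxx //.
rewrite tm_scaleDl // addNr tm_scale0 // tm_add0 //.
by rewrite /typed wfg es et !eqxx.
Qed.

Lemma tm_comp_ten1 g f a : wf (g \oc f) ->
  (g \oc f) \ox tid a ≡ (g \ox tid a) \oc (f \ox tid a).
Proof. by move=> w; rewrite tm_interchange /= ?eqxx // (tm_comp1 (a := a)). Qed.

End LinearMonoidalCalculus.

(** * Quantum integers, factorials and binomials *)

Section QuantumNumbers.
Variables (K : fieldType) (q : K).
Hypotheses (q0 : q != 0) (qq : q - q^-1 != 0).

Lemma qint1 : qint q 1 = 1.
Proof. by rewrite /qint expr1z exprN1 divff. Qed.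

(** Expanding [2][n+1] gives [n] + [n+2]; the coefficient -[n+2] in [mrg_cupcap_spl] comes from
    here. *)
Lemma qint_rec (n : nat) :
  qint q n - qint q 2 * qint q n.+1 = - qint q n.+2.
Proof.
rewrite /qint -!exprnP -!exprnN !exprS expr0.
have qn0 : q ^+ n != 0 by rewrite expf_neq0.
(* [field] clears q^-1 from the denominator q - q^-1, so its side condition concerns q * q - 1. *)
have q2 : q * q - 1 != 0.
  apply: contra_neq qq => e.
  have -> : q - q^-1 = (q * q - 1) / q by field.
  by rewrite e mul0r.
by field; rewrite q0 q2.
Qed.

Lemma qbin0 (a : int) : qbin q a 0 = 1.
Proof. by rewrite /qbin /qfact big_ord0 big_geq // divr1. Qed.

Lemma qbin1 (a : int) : qbin q a 1 = qint q a.
Proof. by rewrite /qbin /qfact big_ord1 big_nat1 qint1 divr1 subr0. Qed.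

Lemma qfact0 : qfact q 0 = 1.
Proof. by rewrite /qfact big_geq. Qed.

Lemma qfactS n : qfact q n.+1 = qfact q n * qint q n.+1.
Proof. by rewrite /qfact big_nat_recr. Qed.

End QuantumNumbers.

#[local] Arguments symM : simpl never.
#[local] Arguments symS : simpl never.

(** * Trees, ladders and the Jones-Wenzl recursion in the spider *)

Section JonesWenzl.
Variables (K : fieldType) (q : K).
Hypotheses (q0 : q != 0) (qq : q - q^-1 != 0).
Hypothesis qint_neq0 : forall n : nat, qint q n.+1 != 0.
Local Open Scope tm_scope.
Local Notation "f ≡ g" := (tmeq (SpRel q) f g) (at level 70).
Local Notation mrg := (mrg K).
Local Notation spl := (spl K).
Local Notation id1 := (sp_id K 1).
Local Notation ones_id n := (@tid K SpSig (ones n)).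

Lemma SpRel_tmeq f g : SpRel q f g -> f ≡ g.
Proof. by move=> fg; apply: tmeq_rel (SpRel_parallel fg). Qed.

Lemma src_symM n : src (symM K n) = ones n.
Proof. by have /and3P[_ /eqP] := symM_typed K n. Qed.

Lemma tgt_symM n : tgt (symM K n) = edge n.
Proof. by have /and3P[_ _ /eqP] := symM_typed K n. Qed.

Lemma wf_symM n : wf (symM K n).
Proof. by have /and3P[] := symM_typed K n. Qed.

Lemma src_symS n : src (symS K n) = edge n.
Proof. by have /and3P[_ /eqP] := symS_typed K n. Qed.

Lemma tgt_symS n : tgt (symS K n) = ones n.
Proof. by have /and3P[_ _ /eqP] := symS_typed K n. Qed.

Lemma wf_symS n : wf (symS K n).
Proof. by have /and3P[] := symS_typed K n. Qed.

Lemma edge1 : edge 1 = ones 1.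
Proof. by []. Qed.

Lemma edgeD1 (n : nat) : edge (n%:Z + 1) = edge n.+1.
Proof. by rewrite -PoszD addn1. Qed.

Definition spE := (src_symM, tgt_symM, wf_symM, src_symS, tgt_symS, wf_symS,
  edgeD1, edge1, ones_cat).

Ltac unfold_terms :=
  repeat match goal with x := _ : tm _ _ |- _ => progress unfold x end.

(** Settles typing side conditions by computing boundaries and normalising concatenations, fusing
    runs of 1; [e] supplies the boundaries of abstract morphisms. *)
Ltac spwf_with e :=
  unfold_terms;
  rewrite /= ?e ?spE -?spcatA ?ones_cat ?addn1 ?addn2;
  rewrite ?e ?ones_cat ?addn2 ?eqxx //.

Ltac spwf := spwf_with spE.

(** The fixpoint treats 1 as a base case, but erasing the 0-labeled edge makes [mrg 0 1] an
    identity, so the recursion also holds from 0. *)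
Lemma symM_rec n : symM K n.+1 ≡ mrg n 1 \oc (symM K n \ox id1).
Proof.
case: n => [|n]; last reflexivity.
rewrite (tm_1ten _ (S := SpSig)) // (SpRel_tmeq (Sp_mrg0l q 1)).
by rewrite tm_comp1.
Qed.

Lemma symS_rec n : symS K n.+1 ≡ (symS K n \ox id1) \oc spl n 1.
Proof.
case: n => [|n]; last reflexivity.
rewrite (tm_1ten _ (S := SpSig)) // (SpRel_tmeq (Sp_spl0l q 1)).
by rewrite tm_comp1.
Qed.

Lemma mrg_spl1 (n : nat) : mrg n 1 \oc spl n 1 ≡ qint q n.+1 *: sp_id K n.+1.
Proof. by rewrite (SpRel_tmeq (Sp_digon q n 1)) qbin1 // addn1. Qed.

(** The inner trees meet and collapse to [n]! by induction; the remaining digon contributes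
    [n+1]. *)
Lemma symM_symS n : symM K n \oc symS K n ≡ qfact q n *: sp_id K n.
Proof.
elim: n => [|n IH].
  by rewrite qfact0 tm_scale1 //= tm_comp1.
rewrite symM_rec symS_rec tm_compA; last by spwf.
rewrite -(tm_compA _ (h := mrg n 1)); last by spwf.
rewrite tm_interchange; [|by spwf..].
rewrite IH (tm_comp1 _ (f := id1)) //.
rewrite tm_tenZl // tm_compZr; last by spwf.
rewrite tm_ten_id (tm_1comp _ (f := mrg n 1)) //.
rewrite tm_compZl; last by spwf.
by rewrite mrg_spl1 tm_scaleA // qfactS.
Qed.

Lemma ladF0 (k l : nat) : ladF K 0 k l ≡ sp_id K k \ox sp_id K l.
Proof.
rewrite /ladF subr0 (SpRel_tmeq (Sp_mrg0l q l)) (SpRel_tmeq (Sp_spl0r q k)).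
by rewrite tm_ten_id tm_comp1.
Qed.

Lemma ladE0 (k l : nat) : ladE K 0 k l ≡ sp_id K k \ox sp_id K l.
Proof.
rewrite /ladE subr0 (SpRel_tmeq (Sp_mrg0r q k)) (SpRel_tmeq (Sp_spl0l q l)).
by rewrite tm_ten_id tm_comp1.
Qed.

(** One end of the rung meets an erased edge, so a single vertex remains. In this way the square
    switch yields a split after a merge. *)
Lemma ladF_target0 (j k : nat) : ladF K j (k + j)%N 0 ≡ spl k j.
Proof.
rewrite /ladF PoszD addrK (SpRel_tmeq (Sp_mrg0r q j)).
rewrite (tm_ten1 (S := SpSig)) // tm_ten_id tm_comp1 //.
Qed.

Lemma ladE_target0 (k l : nat) : ladE K l k l ≡ mrg k l.
Proof.
rewrite /ladE subrr (SpRel_tmeq (Sp_spl0r q l)).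
rewrite (tm_ten1 (S := SpSig)) // tm_ten_id tm_1comp //.
Qed.

(** Square switch with both rungs 1 on (n+1, 1). The term j = 0 passes through (n+2, 0) and gives s
    m; the term j = 1 has empty rungs and coefficient [n]. *)
Lemma ladEF_switch1 (n : nat) :
  ladE K 1 n 2 \oc ladF K 1 n.+1 1
    ≡ spl n.+1 1 \oc mrg n.+1 1 + qint q n *: (sp_id K n.+1 \ox id1).
Proof.
have := SpRel_tmeq (Sp_switch q 1 1 n.+1 1).
have -> : n.+1%:Z - 1%:Z = n by rewrite -[n.+1]addn1 PoszD addrK.
rewrite big_ltn // big_ltn // big_geq // !subr0 !subrr subrK -PoszD => ->.
rewrite qbin0 qbin1 // ladF0 ladE0 ladF_target0 ladE_target0.
rewrite tm_ten_id tm_comp1 // tm_scale1; last by spwf.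
(* The expanded sum ends in its initial value, the zero morphism; the unit law needs it on the
   left. *)
rewrite (tm_addC _ (g := tzero _ _)); last by spwf.
by rewrite tm_add0 // /typed; spwf.
Qed.

(** The identity gets [n] from the square switch and -[2][n+1] from the identity part of the
    dumbbell, in total -[n+2]. *)
Lemma mrg_cupcap_spl (n : nat) :
  (mrg n 1 \ox id1) \oc (sp_id K n \ox (sp_cup K 1 \oc sp_cap K 1))
      \oc (spl n 1 \ox id1)
    ≡ spl n.+1 1 \oc mrg n.+1 1 + (- qint q n.+2)%R *: (sp_id K n.+1 \ox id1).
Proof.
have cupcap : sp_cup K 1 \oc sp_cap K 1
    ≡ spl 1 1 \oc mrg 1 1 + (- qint q 2)%R *: (id1 \ox id1).
  by apply: tm_subr_eq (SpRel_tmeq (Sp_dumbbell q)) _.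
have dumbbell : sp_id K n \ox (spl 1 1 \oc mrg 1 1)
    ≡ (sp_id K n \ox spl 1 1) \oc (sp_id K n \ox mrg 1 1).
  by rewrite tm_interchange /= ?eqxx // tm_comp1.
have switch := ladEF_switch1 n.
have nE : n.+1%:Z - 1%:Z = n by rewrite -[n.+1]addn1 PoszD addrK.
rewrite /ladE /ladF nE in switch.
rewrite cupcap tm_tenDr // tm_tenZr // !tm_ten_id.
rewrite tm_compDr; [|by spwf..].
rewrite tm_compDl; [|by spwf..].
rewrite tm_compZr; last by spwf.
rewrite tm_compZl; last by spwf.
rewrite (tm_1comp _ (f := mrg n 1 \ox id1)); [|by spwf..].
(* The identity part leaves a digon beside a free strand. *)
rewrite (tm_interchange _ (g := mrg n 1) (f := spl n 1)); [|by spwf..].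
rewrite mrg_spl1 tm_comp1 // tm_tenZl // tm_scaleA //.
(* Cutting s m into two layers and regrouping exposes the two ladders of [switch]. *)
rewrite dumbbell tm_compA; last by spwf.
rewrite -tm_compA; last by spwf.
rewrite switch -tm_addA; last by spwf.
rewrite !tm_ten_id tm_scaleDl //.
by rewrite mulNr qint_rec.
Qed.

(** Since [h] touches only the last two strands, it slides past the trees on the first n, which then
    meet and contribute [n]!. *)
Lemma symM_symS_sandwich (n : nat) (h : tm K SpSig) :
    typed (S := SpSig) (ones 2) (ones 2) h ->
  (symM K n.+1 \ox id1) \oc (ones_id n \ox h)
      \oc (symS K n.+1 \ox id1)
    ≡ qfact q n *: ((mrg n 1 \ox id1) \oc (sp_id K n \ox h)
                       \oc (spl n 1 \ox id1)).
Proof.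
move=> /and3P[wh /eqP sh /eqP th].
have hE := (wh, sh, th).
have eM : symM K n.+1 \ox id1
    ≡ (mrg n 1 \ox id1) \oc (symM K n \ox ones_id 2).
  rewrite symM_rec tm_comp_ten1; last by spwf.
  by rewrite -tm_tenA ?wf_symM // tm_ten_id.
have eS : symS K n.+1 \ox id1
    ≡ (symS K n \ox ones_id 2) \oc (spl n 1 \ox id1).
  rewrite symS_rec tm_comp_ten1; last by spwf.
  by rewrite -tm_tenA ?wf_symS // tm_ten_id.
have eMS : (symM K n \ox ones_id 2) \oc (ones_id n \ox h)
    \oc (symS K n \ox ones_id 2) ≡ qfact q n *: (sp_id K n \ox h).
  rewrite tm_interchange; [|by spwf_with hE..].
  rewrite tm_1comp ?spE // tm_comp1 //.
  rewrite tm_interchange; [|by spwf_with hE..].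
  by rewrite tm_1comp // symM_symS tm_tenZl.
rewrite eM eS tm_compA; last by spwf_with hE.
rewrite -(tm_compA _ (h := mrg n 1 \ox id1)); last by spwf_with hE.
rewrite -(tm_compA _ (h := mrg n 1 \ox id1)); last by spwf_with hE.
rewrite eMS tm_compZr; last by spwf_with hE.
by rewrite tm_compZl //; spwf_with hE.
Qed.

Lemma TLtoSp_JW n : TLtoSp_tm (JW_tm q n) ≡ symJW_tm q n.
Proof.
(* At 0 both sides are the empty diagram with scalar 1. *)
case: n => [|n].
  by rewrite /symJW_tm qfact0 invr1 tm_scale1 //= tm_comp1.
elim: n => [|n IH].
  rewrite /symJW_tm qfactS qfact0 mul1r qint1 // invr1 tm_scale1 //.
  by rewrite tm_comp1.
pose h := sp_cup K 1 \oc sp_cap K 1.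
pose S1 := symS K n.+1 \ox id1; pose M1 := symM K n.+1 \ox id1.
pose f := qfact q n.+1.
have -> : TLtoSp_tm (JW_tm q n.+2) =
  (TLtoSp_tm (JW_tm q n.+1) \ox id1)
    + (qint q n.+1 / qint q n.+2)%R *:
       ((TLtoSp_tm (JW_tm q n.+1) \ox id1) \oc (ones_id n \ox h)
        \oc (TLtoSp_tm (JW_tm q n.+1) \ox id1)) by [].
have f0 : f != 0.
  rewrite /f; elim: n.+1 => [|m IHm]; first by rewrite qfact0 oner_eq0.
  by rewrite qfactS mulf_neq0.
have p : TLtoSp_tm (JW_tm q n.+1) \ox id1 ≡ f^-1 *: (S1 \oc M1).
  rewrite IH /symJW_tm tm_tenZl //; last by spwf.
  by rewrite tm_comp_ten1; spwf.
(* Between the two copies of the projector, [M1] and [S1] enclose the cup-cap, so the sandwich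
   applies. *)
have mid : S1 \oc M1 \oc (ones_id n \ox h) \oc (S1 \oc M1) ≡
   qfact q n *: (S1 \oc (spl n.+1 1 \oc mrg n.+1 1) \oc M1
     + (- qint q n.+2)%R *: (S1 \oc M1)).
  rewrite -(tm_compA _ (h := S1)); last by spwf.
  rewrite (tm_compA _ (f := M1)); last by spwf.
  rewrite -(tm_compA _ (h := S1)); last by spwf.
  rewrite symM_symS_sandwich // mrg_cupcap_spl.
  rewrite tm_compZr ?tm_compZl; [|by spwf..].
  rewrite tm_compDr; [|by spwf..].
  rewrite tm_compDl; [|by spwf..].
  rewrite tm_compZr; last by spwf.
  rewrite tm_compZl; last by spwf.
  by rewrite tm_ten_id tm_1comp //; spwf.
(* The two vertices are absorbed as the outermost vertices of the larger trees. *)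
have SM : S1 \oc (spl n.+1 1 \oc mrg n.+1 1) \oc M1
    ≡ symS K n.+2 \oc symM K n.+2.
  rewrite tm_compA; last by spwf.
  by rewrite -tm_compA //; spwf.
have wA : wf (S1 \oc M1) by spwf.
rewrite p tm_compZl; last by spwf.
rewrite tm_compZl; last by spwf.
rewrite tm_compZr; last by spwf.
rewrite mid SM.
rewrite !tm_scaleA; [|by spwf..].
rewrite tm_scaleDr; last by spwf.
rewrite tm_scaleA //.
rewrite (tm_addC _ (g := _ *: (S1 \oc M1))); last by spwf.
rewrite tm_addA; last by spwf.
rewrite tm_scaleDl //.
have a0 := qint_neq0 n; have b0 := qint_neq0 n.+1.
have fE : f = (qfact q n * qint q n.+1)%R by apply: qfactS.
have g0 : qfact q n != 0 by apply: contraNneq f0 => g0; rewrite fE g0 mul0r.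
(* With f = [n]! [n+1], the second summand is -f / f^2, which cancels f^-1. *)
have -> : (f^-1 + qint q n.+1 / qint q n.+2 / f / f * qfact q n
             * - qint q n.+2)%R = 0 by rewrite fE; field; rewrite g0 a0 b0.
have -> : (qint q n.+1 / qint q n.+2 / f / f * qfact q n)%R
    = (qfact q n.+2)^-1%R.
  by rewrite qfactS -/f fE; field; rewrite g0 a0 b0.
by rewrite tm_scale0 // tm_add0 // /typed; spwf.
Qed.

End JonesWenzl.

(** * Nonvanishing of quantum integers at the generic parameter *)

Section GenericParameter.
Variable R : realType.
Local Notation q := (qvar R).

(** Polynomials embed in fractions, and the constant coefficients 0 and 1 differ. *)
Lemma qvar_expn_neq1 n : q ^+ n.+1 != 1.
Proof.
rewrite /qvar -rmorphXn -tofrac1 tofrac_eq.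
apply/eqP => /(congr1 (fun p : {poly R[i]} => p`_0)).
by rewrite coefXn coef1 => /eqP; rewrite eq_sym oner_eq0.
Qed.

Lemma qvar_neq0 : q != 0.
Proof. by rewrite /qvar -tofrac0 tofrac_eq polyX_eq0. Qed.

Lemma qvar_expn_subV_neq0 n : q ^+ n.+1 - q ^- n.+1 != 0.
Proof.
have qn0 : q ^+ n.+1 != 0 by rewrite expf_neq0 ?qvar_neq0.
(* Equality would force q^(2(n+1)) = 1; the exponent is the successor of n + n.+1. *)
rewrite subr_eq0; apply: contraNneq (qvar_expn_neq1 (n + n.+1)) => e.
by rewrite -addSn exprD {1}e mulVf.
Qed.

Lemma qint_qvar_neq0 n : qint q n.+1 != 0.
Proof.
rewrite /qint -exprnP -exprnN mulf_neq0 ?invr_eq0 ?qvar_expn_subV_neq0 //.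
by have := qvar_expn_subV_neq0 0; rewrite expr1.
Qed.

End GenericParameter.

Theorem proposition2p14 (R : realType) (k : nat) (hk : (0 < k)%N) :
  TLtoSp (JW (qvar R) k) = symJW (qvar R) k.
Proof.
(* [TLtoSp_hom] trades the chosen representative of the class for [JW_tm] itself. *)
rewrite /JW TLtoSp_hom; apply/hom_eqP; apply: TLtoSp_JW.
- exact: qvar_neq0.
- by have := qvar_expn_subV_neq0 R 0; rewrite expr1.
- exact: qint_qvar_neq0.
Qed.
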